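(* Let $N\ge 2$ and $q\in(0,1]$ be fixed. For any constant $a_d\in(0,1]$, the semi-dynamic policy $\pi^d$ with parameter $a_d$ flexes $\mathcal{O}(\sqrt T)$ times in expectation, i.e. $\mathbb{E}[M^d]\in\mathcal{O}(\sqrt T)$ as $T\to\infty$.
   Context: Balls-into-bins model: $T$ balls are sequentially allocated into $N\ge 2$ initially empty bins. In each period $t\in\{1,\dots,T\}$ a ball arrives; it has a preferred bin $P(t)$ drawn uniformly at random from $\{1,\dots,N\}$, and it is flexible ($f(t)=1$) with probability $q\in(0,1]$, otherwise $f(t)=0$. All draws are independent across periods and of each other. A policy $\pi$ determines, without anticipating the future, $\omega^\pi(t)\in\{0,1\}$ (whether to exert flexibility in period $t$). If $f(t)\omega^\pi(t)=1$, a flex set $\mathcal F(t)$ of two distinct bins is drawn uniformly at random and the ball is put in the bin of $\mathcal F(t)$ with the smaller current load (ties broken in favour of the smallest index). If $f(t)\omega^\pi(t)=0$ the ball is put in $P(t)$. Let $x_i^\pi(t)$ be the load of bin $i$ at the end of period $t$, $x_i^\pi(0)=0$, $Gap^\pi(t)=\max_{i}x_i^\pi(t)-t/N$, and $M^\pi=\sum_{t=1}^T f(t)\omega^\pi(t)$ the number of flex throws. Semi-dynamic policy $\pi^d$ (superscript $d$) with constant $a_d>0$: it does not flex until the first period $T^\star=\inf\{t: Gap^d(t)\ge \frac{a_d(T-t)q}{N}\}$ and flexes in every period thereafter, i.e. $\omega^d(t)=0$ for $t\le T^\star$ and $\omega^d(t)=1$ for $t>T^\star$. *)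

(* Defs.v *)
(* MathComp / MathComp-Analysis *)
From HB Require Import structures.
From mathcomp Require Import all_boot all_order all_algebra.
From mathcomp Require Import all_classical all_reals all_analysis.
Set Implicit Arguments.
Unset Strict Implicit.
Unset Printing Implicit Defensive.
Import Order.TTheory GRing.Theory Num.Theory.
Import numFieldNormedType.Exports.
Local Open Scope classical_set_scope.
Local Open Scope ring_scope.

(* The draws of one period: preferred bin, flexibility indicator, flex set.
   A flex set is drawn in every period and ignored when no flexibility is
   exerted. *)
Definition draw (N : nat) : finType := ('I_N * bool * {set 'I_N})%type.

Definition preferred N (z : draw N) : 'I_N := z.1.1.
Definition flexible N (z : draw N) : bool := z.1.2.
Definition flex_set N (z : draw N) : {set 'I_N} := z.2.

Definition loads (N : nat) := {ffun 'I_N -> nat}.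

Definition no_loads N : loads N := [ffun=> 0%N].

(* The default [p] only matters for an empty [F]. *)
Definition smallest_load N (p : 'I_N) (x : loads N) (F : {set 'I_N}) : 'I_N :=
  odflt p [pick i in F |
    [forall j in F, (x i < x j)%N || (x i == x j) && (i <= j)%N]].

Definition add_ball N (x : loads N) (i : 'I_N) : loads N :=
  [ffun j => (x j + (j == i))%N].

Definition next_loads N (x : loads N) (w : bool) (z : draw N) : loads N :=
  add_ball x (if flexible z && w
              then smallest_load (preferred z) x (flex_set z)
              else preferred z).

(* In period [t], a policy maps [:: x(0); ...; x(t-1)] to omega(t). *)
Definition policy (N : nat) := seq (loads N) -> bool.

Section Run.
Variables (N : nat) (pi : policy N) (D : nat -> draw N).

(* [:: x(0); ...; x(t)]; the draws of period [t] are [D t], for [t >= 1]. *)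
Fixpoint history (t : nat) : seq (loads N) :=
  if t is s.+1 then
    let h := history s in
    rcons h (next_loads (last (no_loads N) h) (pi h) (D t))
  else [:: no_loads N].

Definition load_at (t : nat) : loads N := last (no_loads N) (history t).

Definition omega (t : nat) : bool := pi (history t.-1).

Definition flex_throws (T : nat) : nat :=
  (\sum_(1 <= t < T.+1) (flexible (D t) && omega t))%N.

Lemma load_at0 : load_at 0 = no_loads N.
Proof. by []. Qed.

Lemma load_atS t :
  load_at t.+1 = next_loads (load_at t) (omega t.+1) (D t.+1).
Proof. by rewrite /load_at /omega /= last_rcons. Qed.

Lemma size_history t : size (history t) = t.+1.
Proof. by elim: t => //= t IH; rewrite size_rcons IH. Qed.

Lemma nth_history s t : (s <= t)%N ->
  nth (no_loads N) (history t) s = load_at s.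
Proof.
elim: t => [|t IH]; first by rewrite leqn0 => /eqP ->.
rewrite leq_eqVlt => /orP[/eqP -> | st].
  by rewrite /load_at -nth_last size_history.
by rewrite /= nth_rcons size_history st IH.
Qed.

Lemma flex_throws_le T : (flex_throws T <= T)%N.
Proof.
rewrite /flex_throws -[leqRHS]subn0 -subSS -[leqRHS]muln1 -sum_nat_const_nat.
by apply: leq_sum => t _; case: (_ && _).
Qed.

End Run.

Section SemiDynamic.
Variables (R : realType) (N T : nat) (q a : R).

Definition gap (x : loads N) (t : nat) : R :=
  (\max_(i < N) x i)%N%:R - t%:R / N%:R.

Definition threshold_reached (x : loads N) (t : nat) : bool :=
  a * (T%:R - t%:R) * q / N%:R <= gap x t.

(* The first period at which the threshold is reached along the history [h],
   and [size h] if there is none. *)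
Definition first_reached (h : seq (loads N)) : nat :=
  find (fun t => threshold_reached (nth (no_loads N) h t) t) (iota 0 (size h)).

Definition semi_dynamic : policy N := fun h => (first_reached h < size h)%N.

Definition Tstar (D : nat -> draw N) : nat :=
  first_reached (history semi_dynamic D T).

Lemma omega_semi_dynamic (D : nat -> draw N) (t : nat) : (0 < t <= T)%N ->
  omega semi_dynamic D t = (Tstar D < t)%N.
Proof.
case: t => [//|t] /= tT.
rewrite /omega /semi_dynamic /Tstar /first_reached /= !size_history.
set p := fun s => _; set p' := fun s => _.
have pp' : {in iota 0 t.+1, p =1 p'}.
  move=> s; rewrite mem_iota /= add0n ltnS => st.
  by rewrite /p /p' !nth_history // (leq_trans st) // ltnW.
have -> : iota 0 T.+1 = iota 0 t.+1 ++ iota t.+1 (T - t).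
  by rewrite -{2}(add0n t.+1) -iotaD addSn subnKC // ltnW.
rewrite find_cat -(eq_in_has pp') size_iota.
have -> : find p (iota 0 t.+1) = find p' (iota 0 t.+1).
  by elim: (iota 0 t.+1) pp' => //= s r IH pp'; rewrite pp' ?mem_head // IH //
     => u ur; apply: pp'; rewrite inE ur orbT.
rewrite (eq_in_has pp'); case: ifP => nh; first by [].
move: nh; rewrite has_find size_iota => ->.
by rewrite ltnNge leq_addr.
Qed.

End SemiDynamic.

(* [D 1, ..., D T] are the random draws of the model.  For finitely many
   discrete random variables, mutual independence is the product rule over all
   products of events (an event may be the whole range). *)
Record model_draws (R : realType) (d : measure_display)
    (Omega : measurableType d) (P : probability Omega R)
    (N T : nat) (q : R) (D : nat -> Omega -> draw N) : Prop := {
  draw_measurable : forall t (z : draw N), (0 < t <= T)%N ->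
    measurable [set w | D t w = z];
  preferred_uniform : forall t (i : 'I_N), (0 < t <= T)%N ->
    P [set w | preferred (D t w) = i] = (N%:R^-1)%:E;
  flexible_proba : forall t, (0 < t <= T)%N ->
    P [set w | flexible (D t w)] = q%:E;
  flex_set_uniform : forall t (F : {set 'I_N}), (0 < t <= T)%N ->
    P [set w | flex_set (D t w) = F] =
      (if #|F| == 2%N then ('C(N, 2)%:R)^-1 else 0)%:E;
  draws_independent :
    forall (A : nat -> {set 'I_N}) (B : nat -> {set bool})
           (C : nat -> {set {set 'I_N}}),
    P [set w | forall t, (0 < t <= T)%N ->
         [/\ preferred (D t w) \in A t, flexible (D t w) \in B t
           & flex_set (D t w) \in C t]] =
    (\prod_(1 <= t < T.+1)
        (P [set w | preferred (D t w) \in A t] *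
         P [set w | flexible (D t w) \in B t] *
         P [set w | flex_set (D t w) \in C t]))%E
}.

Lemma expectation_flex_throws_fin_num (R : realType) (d : measure_display)
    (Omega : measurableType d) (P : probability Omega R) (N T : nat)
    (pi : policy N) (D : nat -> Omega -> draw N) :
  ('E_P[fun w => (flex_throws pi (fun t => D t w) T)%:R])%E \is a fin_num.
Proof.
rewrite unlock ge0_fin_numE; last by apply: integral_ge0 => w _; rewrite lee_fin.
have leT w : ((flex_throws pi (fun t => D t w) T)%:R%:E <= (T%:R : R)%:E)%E.
  by rewrite lee_fin ler_nat flex_throws_le.
rewrite ge0_integralTE => [|w]; last by rewrite lee_fin.
apply: (@le_lt_trans _ _ (\int[P]_w (T%:R)%:E)%E).
  rewrite ge0_integralTE => [|w]; last by rewrite lee_fin.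
  apply: ereal_sup_le => _ [h /= hf <-]; exists h => // w.
  exact: le_trans (hf w) (leT w).
rewrite integral_cst //; have := probability_setT P.
by move=> /= ->; rewrite mule1 ltry.
Qed.

(* Main.v *)
(* Every flex throw comes after [Tstar], and the threshold condition gives
   [a * q / N * (T - Tstar) <= gap(Tstar)].  Up to [Tstar] nothing is flexed, so
   the loads are those of the preferred bins alone.  For these,
   [V(t) = \sum_i (x_i(t) - t / N) ^+ 2] increases by less than 1 per period on
   average, so [E V(Tstar) <= T] by optional stopping; since
   [gap(Tstar) ^+ 2 <= V(Tstar)], the expected gap at [Tstar] is at most
   [sqrt T]. *)
Require Import Defs.
From HB Require Import structures.
From mathcomp Require Import all_boot all_order all_algebra.
From mathcomp Require Import all_classical all_reals all_analysis.
From mathcomp Require Import measurable_realfun ring lra zify.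
Import Order.TTheory GRing.Theory Num.Theory.
Import numFieldNormedType.Exports.
Local Open Scope classical_set_scope.
Local Open Scope ring_scope.

(** Models the run without flexing, frozen as soon as [r] holds. Recursion on the list of preferred
    bins turns optional stopping into an induction on the periods left; the time is returned because
    centring the loads depends on it. *)
Fixpoint stopped_loads N (r : loads N -> nat -> bool) (x : loads N) (t : nat)
    (s : seq 'I_N) : loads N * nat :=
  if r x t then (x, t) else
  if s is i :: s' then stopped_loads N r (add_ball x i) t.+1 s' else (x, t).

Definition preferences N (D : nat -> draw N) (t n : nat) : seq 'I_N :=
  [seq preferred (D s) | s <- iota t n].

(** * Squared deviation of loads that follow the preferences *)

Section Paths.
Variables (R : realType) (N : nat).

Definition sq_deviation (x : loads N) (t : nat) : R :=
  \sum_(i < N) ((x i)%:R - t%:R / N%:R) ^+ 2.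

Lemma sq_deviation_ge0 x t : 0 <= sq_deviation x t.
Proof. by apply: sumr_ge0 => i _; exact: sqr_ge0. Qed.

Lemma sq_deviation0 : sq_deviation (no_loads N) 0 = 0.
Proof. by apply: big1 => i _; rewrite ffunE mul0r subr0 expr0n. Qed.

Lemma sqr_gap_le x t : (0 < N)%N -> gap R x t ^+ 2 <= sq_deviation x t.
Proof.
move=> N0; rewrite /gap.
have [|i ->] := @bigop.eq_bigmax 'I_N (fun i => x i); first by rewrite card_ord.
rewrite /sq_deviation (bigD1 i) //= lerDl.
by apply: sumr_ge0 => j _; exact: sqr_ge0.
Qed.

(* For a fixed bin with centred load [y], the increment [c - 1/N] averages to
   zero, so that the average of [(y + c - 1/N) ^+ 2] is [y ^+ 2 + 1/N - 1/N^2]. *)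
Lemma sum_sq_deviation_add_ball x t : (0 < N)%N ->
  \sum_(j < N) sq_deviation (add_ball x j) t.+1 <= N%:R * (sq_deviation x t + 1).
Proof.
move=> N0; have N0' : N%:R != 0 :> R by rewrite pnatr_eq0 -lt0n.
rewrite exchange_big /=.
have one_bin i : \sum_(j < N) ((add_ball x j i)%:R - t.+1%:R / N%:R) ^+ 2 =
    N%:R * ((x i)%:R - t%:R / N%:R) ^+ 2 + (1 - N%:R^-1) :> R.
  rewrite (bigD1 i) //= ffunE eqxx.
  under eq_bigr => j ji.
    rewrite ffunE eq_sym (negbTE ji) addn0.
    over.
  rewrite sumr_const cardC1 card_ord -[X in _ + X]mulr_natl natrD -(natr1 t) -subn1 natrB //.
  by rewrite [true%:R]mulr1n; field.
under eq_bigr do rewrite one_bin.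
rewrite big_split /= -mulr_sumr sumr_const card_ord mulrDr mulr1 lerD2l.
by rewrite -[leLHS]mulr_natl mulrBr mulr1 divff // gerBl.
Qed.

Lemma sum_tuple_cons (I : finType) (n : nat) (F : seq I -> R) :
  \sum_(s : n.+1.-tuple I) F s = \sum_i \sum_(s : n.-tuple I) F (i :: s).
Proof.
rewrite pair_big /= (reindex (fun p : I * n.-tuple I => [tuple of p.1 :: p.2])) //.
exists (fun s : n.+1.-tuple I => (thead s, [tuple of behead s])) => [[i s] _|s _] /=.
  by congr pair; apply: val_inj.
by rewrite [RHS](tuple_eta s); apply: val_inj.
Qed.

Definition stopped_deviation r x t (s : seq 'I_N) : R :=
  let y := stopped_loads N r x t s in sq_deviation y.1 y.2.

(** Optional stopping in counting form, over all [N ^ n] equally likely continuations. If [r x t]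
    holds the deviation is frozen; otherwise the next ball adds at most 1 on average, and the
    induction hypothesis applies from each resulting state. *)
Lemma sum_sq_deviation_stopped r n x t : (0 < N)%N ->
  \sum_(s : n.-tuple 'I_N)
     stopped_deviation r x t s <=
  N%:R ^+ n * (sq_deviation x t + n%:R).
Proof.
move=> N0; elim: n x t => [|n IH] x t.
  rewrite expr0 mul1r addr0 (big_pred1 [tuple]) => [|s]; last by rewrite [s]tuple0 /= eqxx.
  by rewrite /stopped_deviation /=; case: ifP.
rewrite (sum_tuple_cons _ _ (stopped_deviation r x t)) /stopped_deviation /=; case: (r x t) => /=.
  rewrite sumr_const card_ord sumr_const card_tuple card_ord -mulrnA -expnSr.
  by rewrite -[leLHS]mulr_natl natrX ler_wpM2l ?exprn_ge0 // lerDl.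
apply: le_trans (ler_sum _ (fun i _ => IH (add_ball x i) t.+1)) _.
rewrite -mulr_sumr big_split /= sumr_const card_ord exprSr -mulrA -[X in _ + X]mulr_natl.
rewrite ler_wpM2l ?exprn_ge0 // -natr1.
have := sum_sq_deviation_add_ball x t N0; lra.
Qed.

End Paths.

(** * Pathwise bound on the flex throws of the semi-dynamic policy *)

Section SemiDynamicPath.
Variables (R : realType) (N T : nat) (q a : R) (D : nat -> draw N).
Let pi : policy N := semi_dynamic T q a.
Let Ts := Tstar T q a D.
Let reached : loads N -> nat -> bool := threshold_reached T q a.

Lemma flex_throws_le_Tstar : (flex_throws pi D T <= T - Ts)%N.
Proof.
rewrite /flex_throws big_add1 /=.
apply: (@leq_trans (\sum_(0 <= t < T) (Ts <= t))%N).
  rewrite big_nat [leqRHS]big_nat; apply: leq_sum => t /andP[_ tT].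
  by rewrite omega_semi_dynamic //=; case: flexible.
elim: T => [|n IH]; first by rewrite big_nil.
by rewrite big_nat_recr //=; case: leqP IH; lia.
Qed.

Lemma reached_Tstar : (Ts <= T)%N -> reached (load_at pi D Ts) Ts.
Proof.
move=> TsT.
have := nth_find 0%N (a := fun t => reached (nth (no_loads N) (history pi D T) t) t)
  (s := iota 0 (size (history pi D T))).
rewrite has_find size_iota -/(first_reached T q a _) size_history ltnS => /(_ TsT).
by rewrite nth_iota ?size_history // add0n nth_history.
Qed.

Lemma not_reached_before_Tstar t : (t <= T)%N -> (t < Ts)%N ->
  reached (load_at pi D t) t = false.
Proof.
move=> tT tTs.
have := before_find 0%N tTs.
by rewrite nth_iota ?size_history // add0n nth_history.
Qed.

(** Links the policy to the stopped run: up to and including period [Ts], [omega] is false and each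
    ball goes to its preferred bin. Induction on the number [n] of periods left. *)
Lemma stopped_loads_Tstar t n : (Ts <= T)%N -> (t <= Ts)%N -> (t + n = T)%N ->
  stopped_loads N reached (load_at pi D t) t (preferences N D t.+1 n) =
  (load_at pi D Ts, Ts).
Proof.
move=> TsT; elim: n t => [|n IH] t tTs tnT.
  have -> : t = Ts by lia.
  by rewrite /= if_same.
move: tTs; rewrite leq_eqVlt => /orP[/eqP -> /=|tTs].
  by rewrite reached_Tstar.
have tT : (t < T)%N by lia.
have stepE : load_at pi D t.+1 = add_ball (load_at pi D t) (preferred (D t.+1)).
  by rewrite load_atS omega_semi_dynamic // ltnNge tTs /next_loads andbF.
have := IH t.+1 tTs; rewrite addSnnS => /(_ tnT) <-.
by rewrite stepE /= (not_reached_before_Tstar _ (ltnW tT) tTs).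
Qed.

(* AM-GM: [2 g <= g ^+ 2 / u + u], with [u] to be chosen as [Num.sqrt T]. *)
Lemma flex_throws_le_stopped (u : R) : (0 < N)%N -> 0 < q -> 0 < a -> 0 < u ->
  a * q / N%:R * (flex_throws pi D T)%:R <=
  (stopped_deviation R N reached (no_loads N) 0 (preferences N D 1 T) / u + u) / 2.
Proof.
move=> N0 q0 a0 u0.
have rhs0 : 0 <= (stopped_deviation R N reached (no_loads N) 0 (preferences N D 1 T) / u + u) / 2.
  apply: divr_ge0 => //; apply: addr_ge0; last exact: ltW.
  by apply: divr_ge0; [exact: sq_deviation_ge0|exact: ltW].
have c0 : 0 <= a * q / N%:R by apply: divr_ge0 => //; apply: mulr_ge0; exact: ltW.
have Mle := flex_throws_le_Tstar.
(* [Ts] exceeds [T] only by its default value [T.+1]; truncated subtraction then leaves no flex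
   throws. *)
case: (leqP Ts T) => [TsT|TTs]; last first.
  by move: Mle; rewrite (eqP (ltnW TTs : (T - Ts)%N == 0%N)) leqn0 => /eqP ->; rewrite mulr0.
have := stopped_loads_Tstar 0 T TsT (leq0n _) (add0n _).
rewrite /stopped_deviation load_at0 => -> /=.
apply: (@le_trans _ _ (gap R (load_at pi D Ts) Ts)).
  apply: le_trans (reached_Tstar TsT).
  rewrite -natrB // [leRHS](_ : _ = a * q / N%:R * (T - Ts)%:R); last by ring.
  by rewrite ler_wpM2l // ler_nat.
have := sqr_gap_le R N (load_at pi D Ts) Ts N0.
set g := gap _ _ _; set V := sq_deviation _ _ _ _ => gV.
rewrite ler_pdivlMr // -(ler_pM2r u0) [leRHS]mulrDl divfK ?gt_eqF //.
by have := sqr_ge0 (g - u); nra.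
Qed.

End SemiDynamicPath.

(** * From expectations to averages over preference sequences *)

Section Model.
Context (R : realType) (d : measure_display) (Omega : measurableType d)
  (P : probability Omega R).

(* Unlike [expectation_le], this needs no measurability: both expectations are
   suprema over the simple functions below the integrand. *)
Lemma expectation_le_ge0 (f g : Omega -> R) : (forall w, 0 <= f w <= g w) ->
  ('E_P[f] <= 'E_P[g])%E.
Proof.
move=> fg; rewrite unlock.
rewrite !ge0_integralTE => [|w|w]; rewrite ?lee_fin; first last.
- by case/andP: (fg w).
- by case/andP: (fg w) => /le_trans; apply.
apply: ereal_sup_le => _ [h /= hf <-]; exists h => // w.
by apply: le_trans (hf w) _; rewrite lee_fin; case/andP: (fg w).
Qed.

Context (N T : nat) (q : R) (D : nat -> Omega -> draw N).
Hypothesis hD : model_draws P T q D.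

Definition preference_event (s : seq 'I_N) : set Omega :=
  [set w | preferences N (fun t => D t w) 1 T = s].

(** Puts the event in the product form required by [draws_independent], with flexibility and flex
    set unrestricted. Period [t] has list index [t.-1], since periods start at 1. *)
Lemma preference_eventE (i0 : 'I_N) (s : T.-tuple 'I_N) :
  preference_event s = [set w | forall t, (0 < t <= T)%N ->
    [/\ preferred (D t w) \in [set nth i0 s t.-1]%SET,
        flexible (D t w) \in [set: bool]%SET
      & flex_set (D t w) \in [set: {set 'I_N}]%SET]].
Proof.
apply/seteqP; split => w /=.
  move=> sw [//|t] /= tT; rewrite !inE -sw; split => //.
  by rewrite (nth_map 0%N) ?size_iota // nth_iota // add1n.
move=> sw; apply: (@eq_from_nth _ i0); first by rewrite size_map size_iota size_tuple.
move=> t; rewrite size_map size_iota => tT.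
rewrite (nth_map 0%N) ?size_iota // nth_iota // add1n.
by case: (sw t.+1 tT); rewrite inE => /eqP.
Qed.

Lemma measurable_preference_event (i0 : 'I_N) (s : T.-tuple 'I_N) :
  measurable (preference_event s).
Proof.
(* Measurability is given for single values of a whole draw, hence the finite union over all draws
   with the prescribed preferred bin. *)
rewrite (_ : preference_event s =
  \bigcap_(t in [set t | (0 < t <= T)%N])
  \bigcup_(z in [set z | preferred z = nth i0 s t.-1]) [set w | D t w = z]).
  apply: bigcap_measurableType => t tT; apply: fin_bigcup_measurable => //.
  by move=> z _; exact: (draw_measurable hD).
rewrite (preference_eventE i0); apply/seteqP; split => w /= sw t tT.
  by case: (sw t tT); rewrite inE => /eqP pi _ _; exists (D t w).
by case: (sw t tT) => z /= pz ->; rewrite !inE; split => //; apply/eqP.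
Qed.

Lemma preference_event_proba (i0 : 'I_N) (s : T.-tuple 'I_N) :
  P (preference_event s) = ((N%:R ^+ T)^-1)%:E.
Proof.
rewrite (preference_eventE i0).
rewrite (draws_independent hD (fun t => [set nth i0 s t.-1]%SET)
  (fun=> [set: bool]%SET) (fun=> [set: {set 'I_N}]%SET)).
rewrite (eq_big_nat _ _ (F2 := fun=> (N%:R^-1)%:E)) => [|t tT].
  by rewrite prodEFin prodr_const_nat subn1 /= exprVn.
rewrite (_ : [set w | flexible _ \in _] = setT); last first.
  by apply/seteqP; split => // w _ /=; rewrite inE.
rewrite (_ : [set w | flex_set _ \in _] = setT); last first.
  by apply/seteqP; split => // w _ /=; rewrite inE.
rewrite !probability_setT !mule1 -(preferred_uniform hD (nth i0 s t.-1) tT).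
by congr (P _); apply/seteqP; split => w /=; rewrite inE => /eqP.
Qed.

(** The integrand is a finite combination of indicators of preference events, all of the same
    probability. *)
Lemma expectation_preferences (g : seq 'I_N -> R) : (0 < N)%N ->
  (forall s, 0 <= g s) ->
  ('E_P[fun w => g (preferences N (fun t => D t w) 1 T)] =
   ((\sum_(s : T.-tuple 'I_N) g s) / N%:R ^+ T)%:E)%E.
Proof.
move=> N0 g0; pose i0 := Ordinal N0.
have gE w : g (preferences N (fun t => D t w) 1 T) =
    \sum_(s : T.-tuple 'I_N) g s * \1_(preference_event s) w.
  have sz : size (preferences N (fun t => D t w) 1 T) == T.
    by rewrite size_map size_iota.
  rewrite (bigD1 (Tuple sz)) //= big1 => [|s ns].
    by rewrite addr0 indicE mem_set // mulr1.
  rewrite indicE memNset ?mulr0 // => sw; case/eqP: ns; exact: val_inj.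
have mE := measurable_preference_event i0.
rewrite unlock.
under eq_integral do rewrite gE -sumEFin.
rewrite ge0_integral_sum //; last 2 first.
- by move=> s; apply/measurable_EFinP/measurable_funM => //; apply: measurable_indic.
- by move=> s w _; rewrite lee_fin mulr_ge0.
rewrite mulr_suml -sumEFin; apply: eq_bigr => s _.
under eq_integral do rewrite EFinM.
rewrite ge0_integralZl_EFin //; last by apply/measurable_EFinP; apply: measurable_indic.
rewrite integral_indic // setIT EFinM.
by congr (_ * _)%E; exact: preference_event_proba.
Qed.

End Model.

Theorem theorem2 (R : realType) (N : nat) (q a : R)
    (hN : (2 <= N)%N) (hq : 0 < q <= 1) (ha : 0 < a <= 1)
    (d : nat -> measure_display)
    (Omega : forall T : nat, measurableType (d T))
    (P : forall T : nat, probability (Omega T) R)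
    (D : forall T : nat, nat -> Omega T -> draw N)
    (hD : forall T : nat, model_draws (P T) T q (D T)) :
  (fun T : nat =>
     fine 'E_(P T)[fun w => (flex_throws (semi_dynamic T q a)
                               (fun t => D T t w) T)%:R])
  =O_\oo (fun T : nat => Num.sqrt (T%:R : R)).
Proof.
have N0 : (0 < N)%N by exact: ltnW.
case/andP: hq => q0 _; case/andP: ha => a0 _.
pose c := a * q / N%:R.
have c0 : 0 < c by rewrite divr_gt0 ?mulr_gt0 ?ltr0n.
(* With [u ^+ 2 = T] and the mean of [V] at most [T], the mean of [(V / u + u) / 2] is at most [u];
   dividing the pathwise bound by [c] leaves the constant [c^-1]. *)
apply/eqO_exP; exists c^-1; first by rewrite invr_gt0.
near=> T; have T0 : (0 < T)%N by near: T; exact: nbhs_infty_gt.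
set M := fun w => _%:R; set u := Num.sqrt T%:R.
have u0 : 0 < u by rewrite sqrtr_gt0 ltr0n.
pose V := stopped_deviation R N (threshold_reached T q a) (no_loads N) 0.
pose g s := c^-1 * ((V s / u + u) / 2).
have V0 s : 0 <= V s by exact: sq_deviation_ge0.
have g0 s : 0 <= g s.
  apply: mulr_ge0; first by rewrite invr_ge0 ltW.
  apply: divr_ge0 => //; apply: addr_ge0; last exact: ltW.
  by apply: divr_ge0; [exact: V0|exact: ltW].
have Mg w : 0 <= M w <= g (preferences N (fun t => D T t w) 1 T).
  rewrite ler0n /= ler_pdivlMl //.
  exact: flex_throws_le_stopped.
have EM0 : (0 <= 'E_(P T)[M])%E by apply: expectation_ge0 => w; case/andP: (Mg w).
have EMfin : 'E_(P T)[M]%E \is a fin_num by exact: expectation_flex_throws_fin_num.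
suff : fine 'E_(P T)[M]%E <= c^-1 * u.
  move=> EMu; rewrite ger0_norm ?fine_ge0 // ger0_norm; last exact: ltW.
  exact: EMu.
rewrite -lee_fin fineK //.
(* [M] depends on whole draws, whereas its bound [g] depends on the preferences alone, so its
   expectation is a finite average. *)
apply: le_trans (expectation_le_ge0 _ _ _ _ _ _ Mg) _.
rewrite (expectation_preferences _ _ _ _ _ _ _ _ (hD T)) // lee_fin.
have NT0 : 0 < N%:R ^+ T :> R by rewrite exprn_gt0 // ltr0n.
rewrite ler_pdivrMr //.
rewrite -mulr_sumr -mulrA ler_pM2l ?invr_gt0 // -mulr_suml ler_pdivrMr //.
rewrite big_split /= -mulr_suml sumr_const card_tuple card_ord -[X in _ + X]mulr_natl natrX.
have := sum_sq_deviation_stopped R N (threshold_reached T q a) T (no_loads N) 0 N0.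
rewrite sq_deviation0 add0r -/V -(@sqr_sqrtr _ T%:R) ?ler0n // -/u => sumV.
suff : (\sum_(s : T.-tuple 'I_N) V s) / u <= N%:R ^+ T * u by lra.
by rewrite ler_pdivrMr // -mulrA.
Unshelve. all: by end_near.
Qed.
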